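(* Let $\pi$ be a permutation of size $n$, let $Q = Q(\pi)$ be its RSK recording tableau and let $Q_e = \operatorname{evac}(Q)$. For any $i \geq 1$, $$\operatorname{ls}_{\{i\}}(\pi) = \max\{i + j : j\ge 1,\ Q(1, i) + Q_e(1, j) \leq n \text{ and } Q_e(1, j + 1) \neq Q_e(1, j) + 1\},$$ where the maximum of the empty set is $0$. Here the inequality $Q(1,i)+Q_e(1,j)\le n$ is required to involve existing entries (so $i$ and $j$ are at most the length $\lambda_1$ of the first row of $Q$), and the condition $Q_e(1,j+1)\ne Q_e(1,j)+1$ is considered satisfied when $j=\lambda_1$, i.e. when the entry $Q_e(1,j+1)$ does not exist.
   Context: For a permutation $\pi$ of $[n]=\{1,\dots,n\}$ and $I=\{i_1<\cdots<i_k\}\subseteq[n]$, $\pi_I=\pi(i_1)\cdots\pi(i_k)$; the descent set of a sequence $\sigma$ is $\operatorname{Des}(\sigma)=\{i : \sigma(i)>\sigma(i+1)\}$. For a set $D$ of positive integers, $\operatorname{ls}_D(\pi)=\max\{\#I : I\subseteq[n],\ \operatorname{Des}(\pi_I)=D\}$ (equal to $0$ if there is no such $I$). $Q(\pi)$ is the recording tableau of $\pi$ under the Robinson–Schensted correspondence (row insertion of $\pi(1),\dots,\pi(n)$ in order). For a tableau $T$, $T(1,i)$ is the $i$-th entry of its first row. For a standard Young tableau (SYT) $Q$ with $n$ boxes, $\operatorname{evac}(Q)$ is its image under the Schützenberger involution (evacuation), an SYT of the same shape, defined by a growth diagram as follows. Define partitions $\Lambda_{i,j}$, $0\le i\le j\le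 n$, with $|\Lambda_{i,j}|=j-i$: $\Lambda_{0,j}$ is the shape formed by the boxes of $Q$ with entries at most $j$; $\Lambda_{i,i}=\varnothing$; and for $1\le i<j\le n$, $\Lambda_{i,j}$ satisfies $\Lambda_{i,j-1}\subset\Lambda_{i,j}\subset\Lambda_{i-1,j}$ and is chosen different from $\Lambda_{i-1,j-1}$ whenever possible (there are at most two partitions strictly between $\Lambda_{i,j-1}$ and $\Lambda_{i-1,j}$). Then $\operatorname{evac}(Q)$ is the SYT encoded by the chain $\varnothing=\Lambda_{n,n}\subset\Lambda_{n-1,n}\subset\cdots\subset\Lambda_{0,n}$ (the entry $i$ is in the box $\Lambda_{n-i,n}\setminus\Lambda_{n-i+1,n}$). *)

(* Defs.v *)
From mathcomp Require Import all_boot all_fingroup finmap.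

Set Implicit Arguments.
Unset Strict Implicit.
Unset Printing Implicit Defensive.

Local Open Scope nat_scope.

(* Positions are counted from 1, as in Des(s) = {i : s(i) > s(i+1)}. *)
Definition Des (s : seq nat) : {fset nat} :=
  [fset i in iota 1 (size s).-1 | nth 0 s i < nth 0 s i.-1]%fset.

(* One-line notation with values in {1, ..., n}; [enum I] lists the elements of
   I in increasing order. *)
Definition subword n (pi : 'S_n) (I : {set 'I_n}) : seq nat :=
  [seq (pi k : nat).+1 | k <- enum I].

(* Descent sets of finite words are finite, so an infinite D would give 0. *)
Definition ls (D : {fset nat}) n (pi : 'S_n) : nat :=
  \max_(I : {set 'I_n} | Des (subword pi I) == D) #|I|.

(* Tableaux are lists of rows, in English notation. *)
Notation tableau := (seq (seq nat)).

(* [entry1 T i] is T(1, i), meaningful for 1 <= i <= [len1 T]. *)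
Definition len1 (T : tableau) : nat := size (head [::] T).
Definition entry1 (T : tableau) (i : nat) : nat := nth 0 (head [::] T) i.-1.

(* The second component is the bumped entry, if any. *)
Fixpoint row_insert (x : nat) (r : seq nat) : seq nat * option nat :=
  if r is y :: r' then
    if x < y then (x :: r', Some y)
    else let (r1, b) := row_insert x r' in (y :: r1, b)
  else ([:: x], None).

(* The second component is the index (from 0) of the row of the new box. *)
Fixpoint tab_insert (x : nat) (P : tableau) : tableau * nat :=
  if P is r :: P' then
    let (r1, b) := row_insert x r in
    if b is Some y then let (P1, k) := tab_insert y P' in (r1 :: P1, k.+1)
    else (r1 :: P', 0)
  else ([:: [:: x]], 0).

Definition record_at (k m : nat) (Q : tableau) : tableau :=
  set_nth [::] Q k (rcons (nth [::] Q k) m).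

Definition RS_step (PQ : tableau * tableau) (x : nat) : tableau * tableau :=
  let (P1, k) := tab_insert x PQ.1 in
  (P1, record_at k (sumn (shape PQ.2)).+1 PQ.2).

Definition RS (w : seq nat) : tableau * tableau := foldl RS_step ([::], [::]) w.

Definition Qtab n (pi : 'S_n) : tableau := (RS (subword pi [set: 'I_n])).2.

(* Partitions are weakly decreasing lists of positive parts. *)
Definition is_part (la : seq nat) : bool := sorted geq la && (0 \notin la).

Definition subpart (la mu : seq nat) : bool :=
  all (fun k => nth 0 la k <= nth 0 mu k) (iota 0 (size la)).

Definition shape_upto (Q : tableau) (j : nat) : seq nat :=
  [seq k <- [seq count (fun x => x <= j) r | r <- Q] | 0 < k].

Definition between (la mu : seq nat) : seq (seq nat) :=
  [seq nu <- [seq incr_nth la k | k <- iota 0 (size la).+1]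
     | is_part nu && subpart nu mu].

(* A partition between la and mu, different from ka if there is one. *)
Definition growth_rule (la ka mu : seq nat) : seq nat :=
  head (head [::] (between la mu)) [seq nu <- between la mu | nu != ka].

(* [Lambda Q i j] is the partition Lambda_{i,j} of the growth diagram. *)
Fixpoint Lambda (Q : tableau) (i : nat) : nat -> seq nat :=
  if i is i'.+1 then
    fix row (j : nat) : seq nat :=
      if j is j'.+1 then
        if j <= i then [::]
        else growth_rule (row j') (Lambda Q i' j') (Lambda Q i' j)
      else [::]
  else shape_upto Q.

(* The entry m is put in the row where Lambda_{n-m,n} and Lambda_{n-m+1,n}
   differ; they differ by one box, so the entries of a row come in the order in
   which its boxes are added. *)
Definition evac (Q : tableau) : tableau :=
  let n := sumn (shape Q) in
  mkseq (fun r => [seq m <- iota 1 n |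
                     nth 0 (Lambda Q (n - m) n) r
                       != nth 0 (Lambda Q (n - m).+1 n) r])
        (size (Lambda Q 0 n)).

(* Main.v *)
Require Import Defs.
From mathcomp Require Import all_boot all_fingroup finmap zify.

(** Write w for the one-line notation of the permutation and L(u) for the length
    of a longest increasing subsequence of a word u.

    Both first rows that occur in the formula record growth of L.  By Schensted's
    theorem L(u) is the length of the first row of the insertion tableau of u, so
    Q(1, i) is the least length of a prefix p of w with L(p) >= i
    ([head_Q_tab], [lis_le], [lis_ex]).  Dually, evac(Q)(1, j) is the least
    length of a suffix s of w with L(s) >= j ([head_evac_Q_tab]).  This holds
    because the partition Lambda_{i,j} of the growth diagram is the shape of the
    factor w_{i+1} ... w_j ([Lambda_RS_shape]), and that reduces to one square
    of the diagram: for a word u and letters x, y, the shapes of u, xu, uy and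
    xuy obey the local rule of evacuation ([corner_RS]).

    The local rule is proved by deleting the maximal letter M of xuy.  Row
    insertion never lets M bump anything, so in a word containing M the tableau
    is that of the word without M, with M at the end of some row; when letters
    are appended, this mark moves to the next row exactly when the new box hits
    it ([row_len_insert_max_rcons]).  If M is x or y, the local rule can be read
    off.  If M is in u, the eight shapes with and without M form a cube.  The
    face without M obeys the local rule by induction, two faces obey the row
    rule for the mark, one face obeys the analogous column rule by induction,
    and then the two remaining faces are forced by a computation with boxes
    ([cube]).  Thus the column rule, which concerns letters prepended to a word,
    is obtained without column insertion.

    The formula is then elementary.  A subsequence with descent set {i} and
    i + k letters uses an increasing sequence of length i in a prefix and one of
    length k in the remaining suffix, so Q(1, i) + evac(Q)(1, k) <= n.  If no
    j >= k satisfied all conditions, then every suffix starting between the two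
    letters of the descent would have a larger L than the next one.  But
    consecutive such suffixes start with increasing letters, as each longest
    increasing subsequence of the first continues with the first letter of the
    second; so there would be no descent ([two_runs_upper]).  Conversely, for an
    admissible j let x end an increasing sequence of length i in the prefix and
    let y start one of length j in the suffix.  If x < y, then the letter z just
    before y satisfies z > y, since otherwise j + 1 would be reached one step
    after j, which the last condition excludes; adding z to the first sequence
    and deleting its first letter creates the descent ([two_runs_lower]). *)

(** * Row insertion and the shape of the insertion tableau *)

Definition P_tab (w : seq nat) : tableau := (RS w).1.
Definition row_len (w : seq nat) (r : nat) : nat := nth 0 (shape (P_tab w)) r.

(** A box added to a shape lies at the end of its row, so the row index names it.
    Shapes are functions from rows to lengths, which avoids trailing zeros. *)
Definition box (f : nat -> nat) (r : nat) (g : nat -> nat) : Prop :=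
  forall s, g s = f s + (s == r).

Lemma RS_rcons w x : RS (rcons w x) = RS_step (RS w) x.
Proof. by rewrite /RS foldl_rcons. Qed.

Lemma P_tab_rcons w x : P_tab (rcons w x) = (tab_insert x (P_tab w)).1.
Proof. by rewrite /P_tab RS_rcons /RS_step; case: tab_insert. Qed.

Lemma size_row_insert x r :
  size (row_insert x r).1 = size r + ~~ (row_insert x r).2.
Proof.
elim: r => //= y r IH; case: ltnP => _ //=; first by rewrite addn0.
by move: IH; case: row_insert => r1 b /= h; apply: (congr1 S h).
Qed.

Lemma shape_tab_insert x P :
  shape (tab_insert x P).1 = incr_nth (shape P) (tab_insert x P).2.
Proof.
elim: P x => //= r P IH x; have := size_row_insert x r.
case: row_insert => r1 [y|] /= h; last by rewrite h addn1.
by move: (IH y); case: tab_insert => P1 k /= ->; rewrite h addn0.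
Qed.

Lemma shape_record_at k m T : shape (record_at k m T) = incr_nth (shape T) k.
Proof.
rewrite /record_at; elim: T k => [|r T IH] [|k] //=.
- by congr cons; elim: k => //= k ->.
- by rewrite size_rcons.
- by rewrite -IH.
Qed.

Lemma nth_incr v k s : nth 0 (incr_nth v k) s = nth 0 v s + (s == k).
Proof. by rewrite nth_incr_nth addnC eq_sym. Qed.

Lemma row_len_rcons w x :
  box (row_len w) (tab_insert x (P_tab w)).2 (row_len (rcons w x)).
Proof. by move=> s; rewrite /row_len P_tab_rcons shape_tab_insert nth_incr. Qed.

Lemma box_inj f g r r' : box f r g -> box f r' g -> r = r'.
Proof. by move=> h h'; have := h' r; rewrite h eqxx; case: eqP => //; lia. Qed.

(** * The maximal letter of a word *)

Lemma row_insert_rcons_max y M r : y < M ->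
  row_insert y (rcons r M) =
    if (row_insert y r).2 is Some z then (rcons (row_insert y r).1 M, Some z)
    else ((row_insert y r).1, Some M).
Proof.
move=> yM; elim: r => [|z r IH] /=; first by rewrite yM.
by case: ltnP => //= _; rewrite IH; case: row_insert => r1 [].
Qed.

Lemma row_insert_max M r : all (ltn^~ M) r -> row_insert M r = (rcons r M, None).
Proof.
by elim: r => //= z r IH /andP[zM /IH ->]; rewrite ltnNge (ltnW zM).
Qed.

Lemma row_insert_bump y r z : (row_insert y r).2 = Some z -> z \in r.
Proof.
elim: r => //= x r IH; case: ltnP => _ /=; first by case=> ->; rewrite mem_head.
by move: IH; case: row_insert => r1 b /= h /h; rewrite inE => ->; rewrite orbT.
Qed.

Lemma tab_insert_max M T : all (all (ltn^~ M)) T ->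
  tab_insert M T = (record_at 0 M T, 0).
Proof. by case: T => //= r T /andP[/row_insert_max -> _]. Qed.

(** Fomin's local rule: row of the maximal letter after an insertion that creates
    a box in row [b], when the letter was in row [m]. *)
Definition row_bump (m b : nat) : nat := if m == b then m.+1 else m.

(** The maximal letter bumps nothing while it stays in place, and it is bumped only
    by an insertion that reaches the end of its row.  It then enters the next row
    at its end, since everything there is smaller. *)
Lemma tab_insert_record_max y M T k :
    y < M -> all (all (ltn^~ M)) T -> k <= size T ->
  (tab_insert y (record_at k M T)).1 =
    record_at (row_bump k (tab_insert y T).2) M (tab_insert y T).1
  /\ row_bump k (tab_insert y T).2 <= size (tab_insert y T).1.
Proof.
rewrite /record_at.
elim: T y k => [|r T IH] y [|k] //= yM; first by rewrite yM.
- move=> /andP[rM TM] _; rewrite row_insert_rcons_max //.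
  case E: (row_insert y r) => [r1 [z|]] /=; last first.
    by rewrite (tab_insert_max M T) //; case: (T).
  by case: (tab_insert z T).
- move=> /andP[rM TM]; rewrite ltnS => kT.
  case E: (row_insert y r) => [r1 [z|]] //=.
  have zM : z < M by apply: (allP rM); apply: (row_insert_bump y); rewrite E.
  have := IH _ _ zM TM kT; case: tab_insert => T1 b /=.
  case: tab_insert => T2 b2 /= [-> h].
  by move: h; rewrite /row_bump eqSS; case: eqP.
Qed.

Lemma perm_row_insert x r :
  perm_eq ((row_insert x r).1 ++
             (if (row_insert x r).2 is Some z then [:: z] else [::])) (x :: r).
Proof.
elim: r => //= y r IH; case: ltnP => _ /=.
  by rewrite perm_cons cats1 perm_rcons.
move: IH; case: row_insert => r1 b /= IH.
apply: (@perm_trans _ (y :: x :: r)); first by rewrite perm_cons.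
exact: (permEl (perm_catCA [:: y] [:: x] r)).
Qed.

Lemma tab_insert_all (p : pred nat) x T :
  p x -> all (all p) T -> all (all p) (tab_insert x T).1.
Proof.
elim: T x => /= [|r T IH] x px; first by rewrite px.
case/andP=> pr pT; have := perm_all p (perm_row_insert x r).
rewrite all_cat /= px pr /=; case: row_insert => r1 [y|] /=; last first.
  by rewrite andbT pT => ->.
rewrite andbT => /andP[p1 py]; move: (IH y py pT); case: tab_insert => T1 k /=.
by rewrite p1.
Qed.

Lemma P_tab_all (p : pred nat) w : all p w -> all (all p) (P_tab w).
Proof.
elim/last_ind: w => // w x IH; rewrite all_rcons P_tab_rcons => /andP[px pw].
by apply: tab_insert_all => //; apply: IH.
Qed.

(** The entries other than [M] evolve as if [M] were absent. *)
Lemma P_tab_insert_max M w1 w2 :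
    all (ltn^~ M) (w1 ++ w2) ->
  exists2 m, P_tab (w1 ++ M :: w2) = record_at m M (P_tab (w1 ++ w2))
           & m <= size (P_tab (w1 ++ w2)).
Proof.
elim/last_ind: w2 => [|w2 y IH].
  rewrite cats0 cats1 P_tab_rcons => h; exists 0 => //.
  by rewrite tab_insert_max //; apply: P_tab_all.
rewrite -rcons_cons -!rcons_cat all_rcons !P_tab_rcons => /andP[yM h].
have [m -> mle] := IH h.
have [e l] := tab_insert_record_max _ _ _ _ yM (P_tab_all _ _ h) mle.
by eexists; [exact: e|].
Qed.

Lemma row_len_insert_max M w1 w2 : all (ltn^~ M) (w1 ++ w2) ->
  exists m, box (row_len (w1 ++ w2)) m (row_len (w1 ++ M :: w2)).
Proof.
move=> /P_tab_insert_max[m e _]; exists m => s.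
by rewrite /row_len e shape_record_at nth_incr.
Qed.

Lemma row_len_rcons_max M w : all (ltn^~ M) w -> box (row_len w) 0 (row_len (rcons w M)).
Proof.
move=> h; have := row_len_rcons w M.
by rewrite tab_insert_max //; apply: P_tab_all.
Qed.

(** The row rule for the mark of [M], on shapes only. *)
Lemma row_len_insert_max_rcons M w1 w2 y m b :
    y < M -> all (ltn^~ M) (w1 ++ w2) ->
    box (row_len (w1 ++ w2)) m (row_len (w1 ++ M :: w2)) ->
    box (row_len (w1 ++ w2)) b (row_len (w1 ++ rcons w2 y)) ->
  box (row_len (w1 ++ rcons w2 y)) (row_bump m b) (row_len (w1 ++ M :: rcons w2 y)).
Proof.
move=> yM h bm bb; have [m' e mle] := P_tab_insert_max _ _ _ h.
have em : m' = m.
  by apply: box_inj bm => s; rewrite /row_len e shape_record_at nth_incr.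
have eb : (tab_insert y (P_tab (w1 ++ w2))).2 = b.
  by apply: box_inj bb; rewrite -rcons_cat; apply: row_len_rcons.
rewrite -rcons_cons -!rcons_cat => s; rewrite /row_len !P_tab_rcons e.
have [-> _] := tab_insert_record_max _ _ _ _ yM (P_tab_all _ _ h) mle.
by rewrite em eb shape_record_at nth_incr.
Qed.

Definition addbox (f : nat -> nat) (r : nat) : nat -> nat := fun s => f s + (s == r).
(** * The local rules on a cube of shapes *)

Definition nonincr (f : nat -> nat) : Prop := forall r, f r.+1 <= f r.

Lemma nonincr_le f s t : nonincr f -> s <= t -> f t <= f s.
Proof.
move=> pf /subnKC <-; elim: (t - s) => [|d IH]; first by rewrite addn0.
by rewrite addnS; apply: leq_trans IH.
Qed.

(** The transpose of [row_bump]: when the mark in row [m] is hit by the box [a], it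
    moves to the next column.  In the shape [g] that already contains [a], the end
    of that column is in the first row that has the length of row [a]. *)
Definition col_bump (g : nat -> nat) (m a m' : nat) : Prop :=
  if m == a then [/\ m' <= a, g m' = g a & forall s, s < m' -> g m' < g s]
  else m' = m.

(** Evacuation's local rule.  Boxes [a] and [b] extend the same shape [f], and [a']
    completes the square on the side of [b].  Different boxes commute.  If [a] is
    [b], there must be no other partition in the middle, so [a'] is adjacent to
    [a]: to its right, or below it, which needs equal rows [a] and [a.+1] in [f]. *)
Definition slide (f : nat -> nat) (a b a' : nat) : Prop :=
  if a == b then a' = a \/ a' = a.+1 /\ f a.+1 = f a else a' = a.

(** Given are the square [f], [f + a], [f + b], [f + b + a'] obeying the evacuation
    rule and the mark [m] on [f], moved to [ma] on [f + a] by the column rule and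
    to [mb] on [f + b] by the row rule.  The row rule then gives the mark [mm] on
    the fourth shape.  The claim is that [mm] also comes from [mb] by the column
    rule, and that the four shapes enlarged by their marks obey the evacuation
    rule.  A mark different from [a] and [b] is never moved.  The delicate cases
    are those in which the mark meets two boxes: there the rows or columns next to
    the boxes have equal lengths, so that both orders of the rules end in the same
    box. *)
Lemma cube f a b a' m ma :
    nonincr (addbox f a) -> nonincr (addbox f b) -> nonincr (addbox f m) ->
    nonincr (addbox (addbox f b) a') ->
    slide f a b a' -> col_bump (addbox f a) m a ma ->
    let mb := row_bump m b in
    let b' := if a == b then a' else b in
    let mm := row_bump ma b' in
  col_bump (addbox (addbox f b) a') mb a' mm /\
  slide (addbox f m) (if m == a then ma else a) (if m == b then mb else b)
        (if mb == a' then mm else a').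
Proof.
rewrite /addbox /slide /col_bump /row_bump => pa pb pm pba.
have la s t := @nonincr_le _ s t pa; have lb s t := @nonincr_le _ s t pb.
case: (eqVneq a b) pba => [<-{b pb lb}|ab] pba ha.
  case: (eqVneq m a) => [->{m pm}|nma].
    (* The mark and both boxes coincide; the column rule sends the mark to [a']
       if [a'] is right of [a], and the row rule does if [a'] is below [a]. *)
    move=> [l1 e1 min1].
    case: ha pba => [->|[-> ha]] pba.
      have -> : ma = a.
        apply/eqP; rewrite eqn_leq l1 leqNgt; apply/negP => l2.
        have ea : a.-1.+1 = a by lia.
        have := pba a.-1; have := la ma a.-1; rewrite ea; lia.
      by rewrite eqxx gtn_eqF // ltn_eqF.
    have -> : (ma == a.+1) = false by lia.
    rewrite eqxx; split=> //.
    split; [lia|lia|] => s sl; have := min1 s sl; lia.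
  move=> ->; have -> : (m == a') = false.
    by apply/eqP => e; case: ha => [|[]]; have := pm a; lia.
  split=> //; rewrite eqxx; case: ha => [h|[h1 h2]]; [by left|right; split=> //].
  by have := pm a; lia.
subst a'; case: (eqVneq m a) pm => [-> pm [l1 e1 min1]|nma pm ->].
  rewrite eqxx (negbTE ab) eqxx.
  case: (eqVneq ma b) => [emb|nmb]; last first.
    by split=> //; split=> [||s sl]; [lia|lia|have := min1 s sl; lia].
  rewrite emb in l1 e1 min1 *.
  (* The mark was moved onto [b] by [a] and is then moved by [b] to the next row;
     the two rows have these lengths, so that box is below [b] and ends its column. *)
  have fb1 : f b.+1 + (b.+1 == a) = f b.
    have ea : a.-1.+1 = a by lia.
    have := pa b; have := la b.+1 a.-1; have := pa a.-1; rewrite ea.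
    case: (ltngtP b.+1 a) => [h|h|h]; [lia|lia|subst; lia].
  split; last by right; lia.
  split=> [||s sl]; [lia|lia|].
  by case: (ltngtP s b) => [h||]; [have := min1 s; lia|lia|move=> e; subst; lia].
case: (eqVneq m b) => [emb|nmb]; last by rewrite (negbTE nma) (negbTE ab).
have e2 : (if b.+1 == a then b.+1 else a) = a by case: eqP.
rewrite emb e2; split; last by case: eqP; auto.
case: eqP => // e; subst a; rewrite eqxx; split=> // s sl.
have := lb s b; have := pa b; lia.
Qed.

(** * The local rule for prepending and appending a letter *)

Lemma nonincr_ext f g : f =1 g -> nonincr f -> nonincr g.
Proof. by move=> e pf r; rewrite -!e. Qed.

Lemma slide_ext f g a b a' : f =1 g -> slide f a b a' -> slide g a b a'.
Proof. by move=> e; rewrite /slide !e. Qed.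

Lemma col_bump_ext f g m a m' : f =1 g -> col_bump f m a m' -> col_bump g m a m'.
Proof.
move=> e; rewrite /col_bump -!e; case: eqP => // _ [? ? h].
by split=> // s sl; rewrite -e; apply: h.
Qed.

Lemma box_addbox f r g : box f r g -> addbox f r =1 g.
Proof. by move=> h s; rewrite h. Qed.

Lemma split_at_max (w : seq nat) : uniq w -> w != [::] ->
  exists w1 M w2, w = w1 ++ M :: w2 /\ all (ltn^~ M) (w1 ++ w2).
Proof.
move=> uw w0; have [M Mw Mmax] : exists2 M, M \in w & all (leq^~ M) w.
  elim: w w0 {uw} => // x [|y w] IH _; first by exists x; rewrite ?mem_head //= leqnn.
  have [//|M Mw Mmax] := IH; case: (leqP x M) => xM.
    by exists M; [rewrite inE Mw orbT|rewrite /= xM].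
  have h : all (leq^~ x) (y :: w).
    by apply/allP => z /(allP Mmax) zM; apply: leq_trans zM (ltnW xM).
  by exists x; [rewrite mem_head|rewrite /= leqnn].
move: uw Mmax; case/splitPr: Mw => w1 w2 uw Mmax; exists w1, M, w2; split=> //.
apply/allP => z zw; rewrite /= ltn_neqAle.
have -> : z <= M.
  by apply: (allP Mmax); move: zw; rewrite !mem_cat inE orbCA => ->; rewrite orbT.
rewrite andbT; apply/eqP => e; move: uw; rewrite -cat1s uniq_catCA /=.
by rewrite -e zw.
Qed.

Lemma nonincr_row_len_insert n (w1 : seq nat) M (w2 : seq nat) :
    (forall w : seq nat, size w < n -> uniq w -> nonincr (row_len w)) ->
    size (w1 ++ w2) < n -> uniq (w1 ++ w2) -> all (ltn^~ M) (w1 ++ w2) ->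
  nonincr (row_len (w1 ++ M :: w2)).
Proof.
move=> H; elim/last_ind: w2 => [|w2 y IH].
  rewrite cats0 cats1 => l u h.
  apply: (nonincr_ext _ _ (box_addbox _ _ _ (row_len_rcons_max _ _ h))).
  by move=> r; have := H _ l u r; rewrite /addbox; lia.
move=> l u; have pn := H _ l u; move: l u.
rewrite -rcons_cat size_rcons rcons_uniq all_rcons => l /andP[_ u] /andP[yM h].
have {}IH := IH (ltnW l) u h; have pl := H _ (ltnW l) u.
have [m bm] := row_len_insert_max _ _ _ h.
have [b bb] : exists b, box (row_len (w1 ++ w2)) b (row_len (w1 ++ rcons w2 y)).
  by rewrite -rcons_cat; eexists; apply: row_len_rcons.
have bm' := row_len_insert_max_rcons _ _ _ _ _ _ yM h bm bb.
apply: (nonincr_ext _ _ (box_addbox _ _ _ bm')) => r.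
have := pl r; have := IH r; have := pn r; rewrite /addbox /row_bump !bm !bb.
by case: (eqVneq m b) => [->|]; lia.
Qed.

(** The mark of the maximal letter always sits at a box that can be added: it
    starts at the end of the first row, and the row rule preserves this. *)
Lemma row_len_nonincr (w : seq nat) : uniq w -> nonincr (row_len w).
Proof.
have [n] := ubnP (size w); elim: n w => // n IH w sw uw.
have [->|w0] := eqVneq w [::]; first by move=> r; rewrite /row_len !nth_nil.
have [w1 [M [w2 [e h]]]] := split_at_max w uw w0.
move: sw uw; rewrite e -cat_rcons -cats1 -catA size_cat /= -cat1s uniq_catCA /=.
rewrite addnS -size_cat ltnS => sw /andP[_ u].
exact: (nonincr_row_len_insert n).
Qed.

(** A maximal first letter starts in the corner and only moves down. *)
Lemma row_len_cons_max M (w : seq nat) m :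
  uniq w -> all (ltn^~ M) w -> box (row_len w) m (row_len (M :: w)) -> row_len w m = 0.
Proof.
elim/last_ind: w m => [|w y IH] m; first by rewrite /row_len !nth_nil.
rewrite rcons_uniq all_rcons => /andP[_ u] /andP[yM h] bm.
have [m0 b0] := row_len_insert_max M [::] w h; have {IH}z := IH _ u h b0.
have bb := row_len_rcons w y; have := row_len_insert_max_rcons M [::] w y _ _ yM h b0 bb.
move/(box_inj _ _ _ _ bm) => ->; rewrite bb /row_bump.
have := row_len_nonincr w u m0; case: eqVneq => [<-|]; lia.
Qed.

Definition corner (w : seq nat) x y : Prop := exists a b a',
  [/\ box (row_len w) a (row_len (x :: w)), box (row_len w) b (row_len (rcons w y)),
      box (row_len (rcons w y)) a' (row_len (x :: rcons w y)) & slide (row_len w) a b a'].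

Lemma corner_opp (w : seq nat) x y a b a' :
    box (row_len w) a (row_len (x :: w)) -> box (row_len w) b (row_len (rcons w y)) ->
    box (row_len (rcons w y)) a' (row_len (x :: rcons w y)) -> slide (row_len w) a b a' ->
  box (row_len (x :: w)) (if a == b then a' else b) (row_len (x :: rcons w y)).
Proof.
rewrite /slide => ba bb ba' h s; rewrite ba' bb ba; move: h.
by case: (eqVneq a b) => [->|_ ->]; rewrite // addnAC.
Qed.

(** That prepending a letter adds one box is part of [corner] for the shorter word
    without the last letter; the induction for [corner] is therefore a hypothesis. *)
Lemma corner_cons n (w : seq nat) x :
    (forall w' x y, size w' < n -> uniq (x :: rcons w' y) -> corner w' x y) ->
    size w <= n -> uniq (x :: w) ->
  exists a, box (row_len w) a (row_len (x :: w)).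
Proof.
move=> H; case/lastP: w => [|w y]; first by exists 0; apply: (row_len_rcons_max x [::]).
rewrite size_rcons => l u; have [a [b [a' [_ _ h _]]]] := H w x y l u.
by exists a'.
Qed.

Lemma uniq_insert M (w1 w2 : seq nat) :
  uniq (w1 ++ w2) -> all (ltn^~ M) (w1 ++ w2) -> uniq (w1 ++ M :: w2).
Proof.
move=> u h; rewrite -cat1s uniq_catCA /= u andbT; apply/negP => /(allP h).
by rewrite /= ltnn.
Qed.

(** [cube] up to pointwise equality, with the shapes as variables. *)
Lemma cube_box f fa fb fm g a b a' m ma :
    box f a fa -> box f b fb -> box fb a' g -> box f m fm ->
    nonincr fa -> nonincr fb -> nonincr fm -> nonincr g ->
    slide f a b a' -> col_bump fa m a ma ->
    let mb := row_bump m b in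
    let mm := row_bump ma (if a == b then a' else b) in
  col_bump g mb a' mm /\
  slide fm (if m == a then ma else a) (if m == b then mb else b)
        (if mb == a' then mm else a').
Proof.
move=> ba bb ba' bm pa pb pm pg sl cb mb mm.
have pe h k : h =1 k -> nonincr k -> nonincr h.
  by move=> e; apply: nonincr_ext => s; rewrite e.
have bba : addbox (addbox f b) a' =1 g by move=> s; rewrite ba' bb.
have [||||||cg sg] := cube f a b a' m ma.
- exact: pe (box_addbox _ _ _ ba) pa.
- exact: pe (box_addbox _ _ _ bb) pb.
- exact: pe (box_addbox _ _ _ bm) pm.
- exact: pe bba pg.
- exact: sl.
- by apply: col_bump_ext cb => s; rewrite ba.
split; first exact: col_bump_ext bba cg.
exact: slide_ext (box_addbox _ _ _ bm) sg.
Qed.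

Lemma box_col_bump f fm fa h m a ma :
    box f m fm -> box f a fa -> box fa ma h -> col_bump fa m a ma ->
  box fm (if m == a then ma else a) h.
Proof.
move=> bm ba bma; rewrite /col_bump; case: (eqVneq m a) => [e _|_ e] s;
  by rewrite bma ba bm e // addnAC.
Qed.

Lemma box_row_bump f fm fb h m b :
    box f m fm -> box f b fb -> box fb (row_bump m b) h ->
  box fm (if m == b then row_bump m b else b) h.
Proof.
move=> bm bb bmb s; rewrite bmb bb bm /row_bump.
by case: (eqVneq m b) => [->|_] //; rewrite addnAC.
Qed.

(** The column rule for the mark of [M] when [x] is prepended, by induction on the
    part of the word after [M]: just after [M] the mark is in the first row, with
    or without [x], and each further letter is an instance of [cube]. *)
Lemma col_bump_corner n (w1 w2 : seq nat) x M m a ma :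
    (forall w' x y, size w' < n -> uniq (x :: rcons w' y) -> corner w' x y) ->
    size (w1 ++ w2) <= n -> uniq (x :: w1 ++ w2) -> all (ltn^~ M) (x :: w1 ++ w2) ->
    box (row_len (w1 ++ w2)) m (row_len (w1 ++ M :: w2)) ->
    box (row_len (w1 ++ w2)) a (row_len (x :: w1 ++ w2)) ->
    box (row_len (x :: w1 ++ w2)) ma (row_len (x :: w1 ++ M :: w2)) ->
  col_bump (row_len (x :: w1 ++ w2)) m a ma.
Proof.
move=> H; elim/last_ind: w2 m a ma => [|w2 y IH] m a ma.
  rewrite !cats0 !cats1 => _ _ h bm _ bma.
  have -> := box_inj _ _ _ _ bm (row_len_rcons_max _ _ (proj2 (andP h))).
  have -> := box_inj _ _ _ _ bma (row_len_rcons_max _ _ h).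
  by rewrite /col_bump; case: eqP => // <-.
move=> l u h bm ba bma.
have l0 : size (w1 ++ w2) < n by move: l; rewrite -rcons_cat size_rcons.
have u0 : uniq (x :: rcons (w1 ++ w2) y) by rewrite rcons_cat.
have [yM h1] : y < M /\ all (ltn^~ M) (x :: w1 ++ w2).
  by move: h; rewrite -rcons_cat -rcons_cons all_rcons => /andP.
have h0 : all (ltn^~ M) (w1 ++ w2) by case/andP: h1.
have u1 : uniq (x :: w1 ++ w2).
  by move: u0; rewrite -rcons_cons rcons_uniq => /andP[].
have [a0 [b0 [a0' [ba0 bb0 ba0' sl]]]] := H (w1 ++ w2) x y l0 u0.
have bb0' := corner_opp _ _ _ _ _ _ ba0 bb0 ba0' sl.
rewrite !rcons_cat in bb0 ba0' bb0'.
have [m0 bm0] := row_len_insert_max _ _ _ h0.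
have [ma0 bma0] := row_len_insert_max M (x :: w1) w2 h1.
have IH0 := IH _ _ _ (ltnW l0) u1 h1 bm0 ba0 bma0.
have -> := box_inj _ _ _ _ bm (row_len_insert_max_rcons _ _ _ _ _ _ yM h0 bm0 bb0).
have -> := box_inj _ _ _ _ ba ba0'.
have -> := box_inj _ _ _ _ bma
  (row_len_insert_max_rcons M (x :: w1) w2 _ _ _ yM h1 bma0 bb0').
have uy : uniq (w1 ++ rcons w2 y) by case/andP: u.
have uw : uniq (w1 ++ w2) by case/andP: u1.
have uM : uniq (w1 ++ M :: w2) by apply: uniq_insert.
by have [] := cube_box _ _ _ _ _ _ _ _ _ _ ba0 bb0 ba0' bm0
  (row_len_nonincr _ u1) (row_len_nonincr _ uy) (row_len_nonincr _ uM)
  (row_len_nonincr _ u) sl IH0.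
Qed.

(** If [M = x], the mark stays in the first column, where the next row is the box
    below; if [M = y], both boxes added by [y] are in the first row; otherwise the
    square of the word without [M] is lifted by [cube]. *)
Lemma corner_RS (w : seq nat) x y : uniq (x :: rcons w y) -> corner w x y.
Proof.
have [n] := ubnP (size w); elim: n w x y => // n IH w x y; rewrite ltnS => l u.
have u1 : uniq (x :: w) by move: u; rewrite -rcons_cons rcons_uniq => /andP[].
have uy : uniq (rcons w y) by case/andP: u.
have [w1 [M [w2 [e h]]]] := split_at_max (x :: rcons w y) u isT.
case: w1 => [|x' w1] in e h *.
  case: e h => <- <-; rewrite /= all_rcons => /andP[yM h].
  have [m bm] := row_len_insert_max x [::] w h.
  have z := row_len_cons_max _ _ _ (proj2 (andP u1)) h bm.
  have bb := row_len_rcons w y.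
  exists m, (tab_insert y (P_tab w)).2, (row_bump m (tab_insert y (P_tab w)).2).
  split=> //; first exact: (row_len_insert_max_rcons x [::]).
  rewrite /slide /row_bump; case: eqVneq => // _; right; split=> //.
  by apply/eqP; rewrite z -leqn0 -[X in _ <= X]z (row_len_nonincr w) //; case/andP: u1.
case: e h => <-; case/lastP: w2 => [|w2 y'].
  rewrite cats1 => /rcons_inj[<- <-]; rewrite cats0 => h.
  have [a ba] := corner_cons n _ _ IH l u1.
  have hw : all (ltn^~ y) w by case/andP: h.
  exists a, 0, a; split=> //; first exact: row_len_rcons_max.
    move=> s; rewrite -rcons_cons (row_len_rcons_max y (x :: w)) // ba.
    by rewrite (row_len_rcons_max y w) // addnAC.
  by rewrite /slide; case: eqP; auto.
have -> : w1 ++ M :: rcons w2 y' = rcons (w1 ++ M :: w2) y' by rewrite rcons_cat.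
case/rcons_inj => ew <-; subst w.
have -> : (x :: w1) ++ rcons w2 y = rcons (x :: w1 ++ w2) y by rewrite -rcons_cat.
rewrite all_rcons => /andP[yM h1].
have h0 : all (ltn^~ M) (w1 ++ w2) by case/andP: h1.
have sw : size (w1 ++ w2) < n.
  by apply: leq_trans l; rewrite !size_cat /= addnS.
have uxy : uniq (x :: rcons (w1 ++ w2) y).
  apply: subseq_uniq u; rewrite /= eqxx -!cats1 -!catA cat_subseq //.
  exact: subseq_cons.
have ux : uniq (x :: w1 ++ w2).
  by move: uxy; rewrite -rcons_cons rcons_uniq => /andP[].
have uy' : uniq (w1 ++ rcons w2 y) by rewrite -rcons_cat; case/andP: uxy.
have uxy' : uniq (x :: w1 ++ rcons w2 y) by rewrite -rcons_cat.
have uM : uniq (w1 ++ M :: w2) by case/andP: u1.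
have [a [b [a' [ba bb ba' sl]]]] := IH _ _ _ sw uxy.
have bb' := corner_opp _ _ _ _ _ _ ba bb ba' sl.
rewrite !rcons_cat in bb ba' bb'.
have [m bm] := row_len_insert_max _ _ _ h0.
have [ma bma] := row_len_insert_max M (x :: w1) w2 h1.
have cb := col_bump_corner n w1 w2 x M m a ma IH (ltnW sw) ux h1 bm ba bma.
have bmb := row_len_insert_max_rcons _ _ _ _ _ _ yM h0 bm bb.
have bmm := row_len_insert_max_rcons M (x :: w1) w2 _ _ _ yM h1 bma bb'.
have [cg sg] := cube_box _ _ _ _ _ _ _ _ _ _ ba bb ba' bm
  (row_len_nonincr _ ux) (row_len_nonincr _ uy') (row_len_nonincr _ uM)
  (row_len_nonincr _ uxy') sl cb.
rewrite /corner !rcons_cat rcons_cons.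
eexists _, _, _; split; last exact: sg.
- exact: box_col_bump bm ba bma cb.
- exact: box_row_bump bm bb bmb.
- exact: box_col_bump bmb ba' bmm cg.
Qed.

(** * The growth diagram of evacuation *)

Lemma nth_inj_notin0 (s t : seq nat) : 0 \notin s -> 0 \notin t ->
  nth 0 s =1 nth 0 t -> s = t.
Proof.
elim: s t => [|x s IH] [|y t] //=; rewrite ?inE ?negb_or.
- by move=> _ /andP[y0 _] /(_ 0) /= e; rewrite -e in y0.
- by move=> /andP[x0 _] _ /(_ 0) /= e; rewrite e in x0.
move=> /andP[_ hs] /andP[_ ht] e; congr cons; first exact: (e 0).
by apply: IH => // k; apply: (e k.+1).
Qed.

Lemma notin0_incr_nth (v : seq nat) k : k <= size v -> 0 \notin v -> 0 \notin incr_nth v k.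
Proof.
elim: v k => [|x v IH] [|k] //=; rewrite !inE !negb_or.
  by move=> _ /andP[].
by rewrite ltnS => kv /andP[-> /(IH _ kv)].
Qed.

Lemma tab_insert_le x P : (tab_insert x P).2 <= size P.
Proof.
elim: P x => //= r P IH x; case: row_insert => r1 [y|] //=.
by have := IH y; case: tab_insert.
Qed.

Definition RS_shape (w : seq nat) : seq nat := shape (P_tab w).

Lemma RS_shape_rcons w x :
  RS_shape (rcons w x) = incr_nth (RS_shape w) (tab_insert x (P_tab w)).2.
Proof. by rewrite /RS_shape P_tab_rcons shape_tab_insert. Qed.

Lemma RS_shape_notin0 w : 0 \notin RS_shape w.
Proof.
elim/last_ind: w => // w x IH; rewrite RS_shape_rcons notin0_incr_nth //.
by rewrite size_map tab_insert_le.
Qed.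

Lemma is_part_RS_shape (w : seq nat) : uniq w -> is_part (RS_shape w).
Proof.
move=> u; rewrite /is_part RS_shape_notin0 andbT; apply/(sortedP 0) => k _.
exact: row_len_nonincr.
Qed.

Lemma is_part_nonincr (s : seq nat) : is_part s -> nonincr (nth 0 s).
Proof.
case/andP=> /(sortedP 0) h _ k; case: (ltnP k.+1 (size s)) => [/h //|l].
by rewrite nth_default.
Qed.

Lemma subpartP (la mu : seq nat) :
  reflect (forall k, nth 0 la k <= nth 0 mu k) (subpart la mu).
Proof.
apply: (iffP allP) => [h k|h k _ //]; case: (ltnP k (size la)) => l.
  by apply: h; rewrite mem_iota.
by rewrite nth_default.
Qed.

Lemma head_eq (T : eqType) (d v : T) s :
  v \in s -> (forall z, z \in s -> z = v) -> head d s = v.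
Proof. by case: s => // z s _ h; apply: h; rewrite mem_head. Qed.

(** By [corner_RS]: if the boxes of [x] and [y] differ, the shapes of [xw] and [wy]
    are the two partitions in the middle and the rule selects the second; if they
    agree, the adjacency in [slide] leaves only one partition in the middle. *)
Lemma growth_rule_RS_shape (w : seq nat) x y : uniq (x :: rcons w y) ->
  growth_rule (RS_shape w) (RS_shape (x :: w)) (RS_shape (x :: rcons w y)) =
    RS_shape (rcons w y).
Proof.
move=> u; have [a [b [a' [ba bb ba' sl]]]] := corner_RS w x y u.
have ux : uniq (x :: w) by move: u; rewrite -rcons_cons rcons_uniq => /andP[].
have uy : uniq (rcons w y) by case/andP: u.
have eb : (tab_insert y (P_tab w)).2 = b by apply: box_inj bb; apply: row_len_rcons.
have nuE : RS_shape (rcons w y) = incr_nth (RS_shape w) b by rewrite RS_shape_rcons eb.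
have nuin : RS_shape (rcons w y) \in between (RS_shape w) (RS_shape (x :: rcons w y)).
  rewrite mem_filter is_part_RS_shape // andTb; apply/andP; split.
    by apply/subpartP => k; rewrite -/(row_len _ k) -/(row_len _ k) ba' leq_addr.
  rewrite nuE; apply: map_f; rewrite mem_iota /= add0n ltnS -eb.
  by rewrite /RS_shape size_map tab_insert_le.
have inP nu : nu \in between (RS_shape w) (RS_shape (x :: rcons w y)) ->
    nu = RS_shape (rcons w y) \/ a != b /\ nu = RS_shape (x :: w).
  rewrite mem_filter => /andP[/andP[pnu /subpartP sub] /mapP[k _ e]].
  have := sub k; rewrite -/(row_len _ k) ba' bb e nth_incr -/(row_len _ k) eqxx.
  have [->|kb] := eqVneq k b; first by left.
  move=> ka; have {ka}ka : k = a' by apply/eqP; move: ka; case: eqP => //; lia.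
  move: sl; rewrite /slide; case: eqVneq => [ab|ab sl].
    case=> [ea|[ea f]]; first by rewrite ka ea ab eqxx in kb.
    have := is_part_nonincr _ pnu a; rewrite e !nth_incr -!/(row_len _ _) ka ea f; lia.
  right; split=> //.
  apply: nth_inj_notin0; [by rewrite -e; case/andP: pnu|exact: RS_shape_notin0|].
  by move=> s; rewrite nth_incr -!/(row_len _ _) ba ka sl.
rewrite /growth_rule; have [ab|ab] := eqVneq a b.
  have al nu : nu \in between (RS_shape w) (RS_shape (x :: rcons w y)) ->
      nu = RS_shape (rcons w y).
    by case/inP=> // -[]; rewrite ab eqxx.
  have -> : RS_shape (x :: w) = RS_shape (rcons w y).
    apply: nth_inj_notin0; [exact: RS_shape_notin0|exact: RS_shape_notin0|] => s.
    by rewrite -!/(row_len _ _) ba bb ab.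
  rewrite (_ : filter _ _ = [::]); first exact: (head_eq _ _ _ _ nuin al).
  apply/eqP; rewrite -[_ == _]negbK -has_filter; apply/hasPn => nu /al ->.
  by rewrite eqxx.
apply: head_eq => [|nu]; rewrite mem_filter.
  rewrite nuin andbT; apply/eqP => e; have := ba b; have := bb b.
  by rewrite /row_len -!/(RS_shape _) e eqxx; move: ab; rewrite eq_sym => /negbTE ->; lia.
by case/andP=> n1 /inP[//|[_ n2]]; rewrite n2 eqxx in n1.
Qed.

Lemma LambdaS Q i j : Lambda Q i.+1 j.+1 =
  if j.+1 <= i.+1 then [::]
  else growth_rule (Lambda Q i.+1 j) (Lambda Q i j) (Lambda Q i j.+1).
Proof. by []. Qed.

Lemma Lambda_RS_shape Q (w : seq nat) : uniq w ->
    (forall j, j <= size w -> shape_upto Q j = RS_shape (take j w)) ->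
  forall i j, j <= size w -> Lambda Q i j = RS_shape (drop i (take j w)).
Proof.
move=> u hQ; elim=> [|i IHi] j; first by rewrite drop0; apply: hQ.
elim: j => [|j IHj] l; first by rewrite take0.
rewrite LambdaS; case: ltnP => ij.
  by rewrite drop_oversize // size_take_min; lia.
rewrite IHj ?IHi ?(ltnW l) //.
have sj : size (take j w) = j by rewrite size_take l.
rewrite (take_nth 0) // !drop_rcons ?sj //; last by lia.
rewrite (drop_nth 0 (n := i)) ?sj // rcons_cons; apply: growth_rule_RS_shape.
rewrite -rcons_cons -(drop_nth 0 (n := i)) ?sj // -drop_rcons ?sj; last by lia.
by rewrite -take_nth // drop_uniq // take_uniq.
Qed.

(** * First rows of the recording tableau and of its evacuation *)

Lemma sumn_incr_nth (v : seq nat) k : sumn (incr_nth v k) = (sumn v).+1.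
Proof.
elim: v k => [|x v IH] [|k] //=; last by rewrite IH addnS.
by elim: k.
Qed.

Definition Q_tab (w : seq nat) : tableau := (RS w).2.

Lemma shape_Q_tab w : shape (Q_tab w) = RS_shape w /\ sumn (RS_shape w) = size w.
Proof.
elim/last_ind: w => // w x [IH1 IH2]; rewrite /Q_tab RS_rcons /RS_step -/(P_tab w).
rewrite RS_shape_rcons sumn_incr_nth IH2 size_rcons.
by case: tab_insert => P1 k /=; rewrite shape_record_at -/(Q_tab w) IH1.
Qed.

Lemma Q_tab_rcons w x :
  Q_tab (rcons w x) = record_at (tab_insert x (P_tab w)).2 (size w).+1 (Q_tab w).
Proof.
have [e1 e2] := shape_Q_tab w.
rewrite {1}/Q_tab RS_rcons /RS_step -/(P_tab w) -/(Q_tab w) e1 e2.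
by case: tab_insert.
Qed.

(** An entry larger than [j] is not counted, and a new row that holds only this entry
    disappears because [shape_upto] drops empty rows. *)
Lemma shape_upto_record j k m (Q : tableau) : j < m -> k <= size Q ->
  shape_upto (record_at k m Q) j = shape_upto Q j.
Proof.
rewrite /shape_upto /record_at ltnNge => /negbTE jm; elim: Q k => [|r Q IH] [|k] //=.
- by rewrite jm.
- by rewrite -cats1 count_cat /= jm !addn0.
- by rewrite ltnS => /IH ->.
Qed.

Lemma record_at_all (p : pred nat) k m (Q : tableau) :
  p m -> all (all p) Q -> all (all p) (record_at k m Q).
Proof.
rewrite /record_at => pm; elim: Q k => [|r Q IH] [|k] //=.
- by rewrite pm.
- by move=> _; elim: k => //=; rewrite pm.
- by rewrite all_rcons pm.
- by case/andP => -> /IH ->.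
Qed.

Lemma Q_tab_le w : all (all (leq^~ (size w))) (Q_tab w).
Proof.
elim/last_ind: w => // w x IH; rewrite Q_tab_rcons size_rcons record_at_all //.
apply: sub_all IH => r; apply: sub_all => z; exact: leqW.
Qed.

Lemma shape_upto_size w : shape_upto (Q_tab w) (size w) = RS_shape w.
Proof.
have [e _] := shape_Q_tab w; rewrite /shape_upto.
rewrite (_ : map _ _ = shape (Q_tab w)); last first.
  by apply/eq_in_map => r /(allP (Q_tab_le w)); rewrite all_count => /eqP.
rewrite e; apply/all_filterP/allP => k kw; rewrite lt0n.
by apply: contraTneq kw => ->; apply: RS_shape_notin0.
Qed.

Lemma size_Q_tab w : size (Q_tab w) = size (P_tab w).
Proof. by have [] := shape_Q_tab w => /(congr1 size); rewrite !size_map. Qed.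

Lemma shape_upto_Q_tab w j : j <= size w -> shape_upto (Q_tab w) j = RS_shape (take j w).
Proof.
elim/last_ind: w => [|w x IH]; first by case: j.
rewrite size_rcons leq_eqVlt => /orP[/eqP->|].
  by rewrite take_oversize ?size_rcons // -(size_rcons w x) shape_upto_size.
rewrite ltnS => jw; rewrite Q_tab_rcons shape_upto_record ?IH //.
  by rewrite -cats1 takel_cat.
by rewrite size_Q_tab tab_insert_le.
Qed.

(** The first row of a tableau lists the steps at which the length of the first row
    of its chain of shapes grows. *)
Definition jumps (g : nat -> nat) n : seq nat := [seq m <- iota 1 n | g m != g m.-1].

Lemma jumpsS g n : jumps g n.+1 =
  if g n.+1 != g n then rcons (jumps g n) n.+1 else jumps g n.
Proof.
rewrite /jumps -{1}(addn1 n) iotaD filter_cat /= add1n /=.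
by case: ifP => _; rewrite ?cats1 ?cats0.
Qed.

Lemma size_jumps g n : g 0 = 0 -> (forall m, m < n -> g m <= g m.+1 <= (g m).+1) ->
  size (jumps g n) = g n.
Proof.
move=> g0; elim: n => [|n IH] h; first by rewrite g0.
rewrite jumpsS; have := h n (leqnn _).
have {}IH := IH (fun m l => h m (ltnW l)).
by case: eqP => [->|] /=; rewrite ?size_rcons IH; lia.
Qed.

Lemma nth_jumps g n j : g 0 = 0 -> (forall m, m < n -> g m <= g m.+1 <= (g m).+1) ->
    1 <= j <= g n ->
  exists m, [/\ nth 0 (jumps g n) j.-1 = m.+1, m < n, g m = j.-1 & g m.+1 = j].
Proof.
move=> g0; elim: n => [|n IH] h; first by rewrite g0; lia.
have {}IH := IH (fun m l => h m (ltnW l)).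
have sj := size_jumps g n g0 (fun m l => h m (ltnW l)).
have [l|l] := leqP j (g n) => jn.
  have [|m [e ml e1 e2]] := IH; first by lia.
  exists m; split=> //; last exact: ltnW.
  by rewrite jumpsS; case: ifP; rewrite // nth_rcons sj ifT //; lia.
have := h n (leqnn _) => hn; exists n; split; [|lia|lia|lia].
rewrite jumpsS ifT; last by apply/eqP; lia.
by rewrite nth_rcons sj ifF ?ifT //; [apply/eqP|]; lia.
Qed.

Lemma head_Q_tab w :
  head [::] (Q_tab w) = jumps (fun m => row_len (take m w) 0) (size w).
Proof.
elim/last_ind: w => // w x IH; rewrite Q_tab_rcons size_rcons jumpsS.
have jw : jumps (fun m => row_len (take m (rcons w x)) 0) (size w) =
          jumps (fun m => row_len (take m w) 0) (size w).
  apply: eq_in_filter => m; rewrite mem_iota => h.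
  by rewrite -cats1 !takel_cat //; lia.
rewrite jw -IH take_oversize ?size_rcons // -cats1 take_size_cat // cats1 row_len_rcons.
rewrite /record_at; case: (tab_insert x (P_tab w)).2 => [|k] /=.
  by rewrite ifT; [case: (Q_tab w)|lia].
by rewrite addn0 eqxx; case: (Q_tab w).
Qed.

Lemma head_evac_Q_tab (w : seq nat) : uniq w ->
  head [::] (evac (Q_tab w)) =
    jumps (fun m => row_len (drop (size w - m) w) 0) (size w).
Proof.
move=> u; have [e1 e2] := shape_Q_tab w; rewrite /evac e1 e2.
have L := Lambda_RS_shape _ _ u (shape_upto_Q_tab w).
have [->|w0] := eqVneq w [::]; first by [].
have n0 : 0 < size w by case: (w) w0.
rewrite L // take_size drop0.
have s0 : 0 < size (RS_shape w).
  by have := e2; case: (RS_shape w) => //= z; rewrite -z in n0.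
rewrite -nth0 nth_mkseq //; apply: eq_in_filter => m; rewrite mem_iota => h.
have -> : size w - m.-1 = (size w - m).+1 by lia.
by rewrite !L // take_size.
Qed.

(** * Schensted's theorem *)

Definition row1 (w : seq nat) : seq nat := head [::] (P_tab w).

Lemma size_row1 w : size (row1 w) = row_len w 0.
Proof. by rewrite /row1 /row_len; case: (P_tab w). Qed.

(** On the row itself, insertion is a replacement at the first larger entry. *)
Lemma row_insertE x r :
  (row_insert x r).1 = set_nth 0 r (find (ltn x) r) x.
Proof.
elim: r => //= y r IH; case: ltnP => //= _.
by move: IH; case: row_insert => r1 b /= ->.
Qed.

Lemma row1_rcons w x :
  row1 (rcons w x) = set_nth 0 (row1 w) (find (ltn x) (row1 w)) x.
Proof.
rewrite -row_insertE /row1 P_tab_rcons; case: (P_tab w) => //= r P.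
by case: row_insert => r1 [y|] //=; case: tab_insert.
Qed.

Lemma path_row_insert x y r : y < x -> x \notin r -> path ltn y r ->
  path ltn y (row_insert x r).1.
Proof.
elim: r y => [|z r IH] y yx; first by rewrite /= yx.
rewrite inE negb_or /= => /andP[nxz xr] /andP[yz pr]; case: ltnP => xz /=.
  rewrite yx /=; move: pr; case: (r) => //= t r' /andP[zt ->].
  by rewrite (ltn_trans xz).
have zx : z < x by rewrite ltn_neqAle eq_sym nxz.
by have := IH z zx xr pr; case: row_insert => r1 b /= ->; rewrite yz.
Qed.

Lemma sorted_row_insert x r : x \notin r -> sorted ltn r ->
  sorted ltn (row_insert x r).1.
Proof.
case: r => // z r; rewrite inE negb_or /= => /andP[nxz xr] pr.
case: ltnP => xz /=.
  by move: pr; case: (r) => //= t r' /andP[zt ->]; rewrite (ltn_trans xz zt).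
have zx : z < x by rewrite ltn_neqAle eq_sym nxz.
by have := path_row_insert _ _ _ zx xr pr; case: row_insert.
Qed.

Lemma subseq_rconsP (t w : seq nat) x : subseq t (rcons w x) ->
  subseq t w \/ exists2 t', t = rcons t' x & subseq t' w.
Proof.
rewrite -subseq_rev rev_rcons; case: (lastP t) => [|t' y]; first by left; rewrite sub0seq.
rewrite rev_rcons /=; case: eqP => [-> |_]; rewrite -?rev_rcons subseq_rev; last by left.
by right; exists t'.
Qed.

Lemma row1_sub (w : seq nat) : {subset row1 w <= w}.
Proof.
move=> z; have : all (all (mem w)) (P_tab w) by apply: P_tab_all; apply/allP.
by rewrite /row1; case: (P_tab w) => //= r P /andP[/allP h _] /h.
Qed.

Lemma row1_sorted (w : seq nat) : uniq w -> sorted ltn (row1 w).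
Proof.
elim/last_ind: w => // w x IH; rewrite rcons_uniq => /andP[xw u].
rewrite row1_rcons -row_insertE; apply: sorted_row_insert (IH u).
by apply: contra xw; apply: row1_sub.
Qed.

Lemma sorted_rcons_last (t : seq nat) x :
  sorted ltn (rcons t x) = sorted ltn t && ((t == [::]) || (last 0 t < x)).
Proof. by case: t => //= y t; rewrite rcons_path. Qed.

(** Half of the usual invariant of patience sorting, with [row1_min]: entry [k] of
    the row is the least last letter of an increasing subsequence of length
    [k.+1]. *)
Lemma row1_ends (w : seq nat) k : uniq w -> k < size (row1 w) ->
  exists t, [/\ subseq t w, sorted ltn t, size t = k.+1 & last 0 t = nth 0 (row1 w) k].
Proof.
elim/last_ind: w k => // w x IH k; rewrite rcons_uniq => /andP[xw u].
rewrite row1_rcons; set c := find _ _; rewrite nth_set_nth /=.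
have cl : c <= size (row1 w) by apply: find_size.
case: eqVneq => [->|kc]; last first.
  rewrite size_set_nth leq_max => h; have kl : k < size (row1 w) by lia.
  have [t [st ? ? ?]] := IH k u kl; exists t; split=> //.
  exact: subseq_trans st (subseq_rcons _ _).
move=> _; case: (posnP c) => [->|c0].
  by exists [:: x]; split=> //; rewrite -cats1 suffix_subseq.
have cl1 : c.-1 < size (row1 w) by lia.
have [t [st so sz la]] := IH c.-1 u cl1; exists (rcons t x); split.
- by rewrite -!cats1 cat_subseq.
- rewrite sorted_rcons_last so la; apply/orP; right.
  have /negbT : (ltn x) (nth 0 (row1 w) c.-1) = false by apply: before_find; rewrite -/c; lia.
  rewrite /= -leqNgt leq_eqVlt => /orP[/eqP e|//].
  by move: xw; rewrite -e (row1_sub w) // mem_nth.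
- by rewrite size_rcons sz prednK.
- by rewrite last_rcons.
Qed.

Lemma row1_min (w t : seq nat) : uniq w -> subseq t w -> sorted ltn t -> t != [::] ->
  size t <= size (row1 w) /\ nth 0 (row1 w) (size t).-1 <= last 0 t.
Proof.
elim/last_ind: w t => [|w x IH] t; first by rewrite subseq0 => _ /eqP ->.
rewrite rcons_uniq => /andP[xw u] st so t0; rewrite row1_rcons.
set c := find _ _; rewrite size_set_nth nth_set_nth /=.
have cl : c <= size (row1 w) by apply: find_size.
case: (subseq_rconsP _ _ _ st) => [st'|[t' e st']].
  have [l1 l2] := IH t u st' so t0; split; first by rewrite leq_max l1 orbT.
  case: eqP => // e; apply: leq_trans l2.
  have sc : c < size (row1 w) by rewrite -e; case: (t) t0 l1.
  have : (ltn x) (nth 0 (row1 w) c) by apply: nth_find; rewrite has_find.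
  by rewrite e; apply: ltnW.
move: so; rewrite e sorted_rcons_last size_rcons last_rcons => /andP[so' h].
have tc : size t' <= c.
  case: eqVneq h => [->//|t'0] /= h; have [l1 l2] := IH t' u st' so' t'0.
  rewrite leqNgt; apply/negP => l3.
  have : (ltn x) (nth 0 (row1 w) c) by apply: nth_find; rewrite has_find; apply: leq_trans l1.
  have : nth 0 (row1 w) c <= nth 0 (row1 w) (size t').-1.
    apply: (sorted_leq_nth leq_trans leqnn) => //; rewrite ?inE; try lia.
    by have := row1_sorted w u; rewrite ltn_sorted_uniq_leq => /andP[].
  by move=> /= h1 h2; lia.
split; first by rewrite leq_max ltnS tc.
rewrite /=; case: eqP => // nc; have lc : size t' < c by lia.
have /negbT : (ltn x) (nth 0 (row1 w) (size t')) = false by apply: before_find.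
by rewrite /= -leqNgt.
Qed.

Lemma lis_le (w t : seq nat) : uniq w -> subseq t w -> sorted ltn t -> size t <= row_len w 0.
Proof.
move=> u st so; have [->//|t0] := eqVneq t [::].
by rewrite -size_row1; have [] := row1_min w t u st so t0.
Qed.

Lemma lis_ex (w : seq nat) : uniq w ->
  exists t, [/\ subseq t w, sorted ltn t & size t = row_len w 0].
Proof.
rewrite -size_row1 => u; case E: (size (row1 w)) => [|k].
  by exists [::]; rewrite sub0seq.
have [|t [? ? ? _]] := row1_ends w k u; first by rewrite E.
by exists t.
Qed.

Lemma lis_rcons w x : row_len w 0 <= row_len (rcons w x) 0 <= (row_len w 0).+1.
Proof. by rewrite row_len_rcons; case: eqP; lia. Qed.

Lemma lis_cons (w : seq nat) x : uniq (x :: w) ->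
  row_len w 0 <= row_len (x :: w) 0 <= (row_len w 0).+1.
Proof.
move=> u.
have [a h] := corner_cons (size w) w x (fun w x y _ => corner_RS w x y) (leqnn _) u.
by rewrite h; case: eqP; lia.
Qed.

(** If the last letter raises the maximum, then it ends every longest increasing
    subsequence. *)
Lemma lis_jump_rcons (w : seq nat) x : uniq (rcons w x) ->
    row_len (rcons w x) 0 = (row_len w 0).+1 ->
  exists u : seq nat, [/\ subseq u w, sorted ltn (rcons u x) & size u = row_len w 0].
Proof.
move=> u e; have [t [st so sz]] := lis_ex _ u.
have uw : uniq w by move: u; rewrite rcons_uniq => /andP[].
case: (subseq_rconsP _ _ _ st) => [st'|[t' et st']].
  by have := lis_le w t uw st' so; rewrite sz e ltnn.
by exists t'; split; rewrite // -?et //; move: sz; rewrite et size_rcons e => -[].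
Qed.

Lemma lis_jump_cons (w : seq nat) x : uniq (x :: w) ->
    row_len (x :: w) 0 = (row_len w 0).+1 ->
  exists v : seq nat, [/\ subseq v w, sorted ltn (x :: v) & size v = row_len w 0].
Proof.
move=> u e; have [t [st so sz]] := lis_ex _ u.
have uw : uniq w by case/andP: u.
case: t st so sz => [|y t]; first by rewrite e.
have nle : subseq (y :: t) w -> sorted ltn (y :: t) -> size (y :: t) <= row_len w 0 by apply: lis_le.
move=> st so sz; move: st => /=; case: eqP => [ey st|_ st]; last first.
  by have := nle st so; rewrite sz e ltnn.
by exists t; split; rewrite -?ey //; move: sz; rewrite e => -[].
Qed.

(** * Prefixes and suffixes *)

(** What is used of the length of the first row along a chain of shapes, each with
    one more box; the entry at index [j.-1] of [jumps g n] is then where [g] reaches [j]. *)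
Definition counter (g : nat -> nat) n : Prop :=
  g 0 = 0 /\ forall m, m < n -> g m <= g m.+1 <= (g m).+1.

Lemma counter_le g n s t : counter g n -> s <= t -> t <= n -> g s <= g t.
Proof.
case=> _ h /subnKC <-; elim: (t - s) => [|d IH] l; first by rewrite addn0.
rewrite addnS in l *; apply: leq_trans (IH (ltnW l)) _.
by case/andP: (h _ l).
Qed.

(** The entries of [jumps g n] and the values of [g] are in Galois connection. *)
Lemma jump_le g n j m : counter g n -> 1 <= j <= g n -> m <= n ->
  (nth 0 (jumps g n) j.-1 <= m) = (j <= g m).
Proof.
move=> c jn mn; case: (c) => g0 h; have [p [-> pn e1 e2]] := nth_jumps g n j g0 h jn.
apply/idP/idP => l; first by rewrite -e2; apply: (counter_le g n).
rewrite ltnNge; apply/negP => l2.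
by have := counter_le g n m p c l2 (ltnW pn); lia.
Qed.

Lemma jump_at g n j m : counter g n -> m <= n -> 0 < j -> g m.-1 < j -> g m = j ->
  nth 0 (jumps g n) j.-1 = m.
Proof.
move=> c mn j0 l e.
have jn : 1 <= j <= g n by rewrite j0 -e (counter_le g n).
apply/eqP; rewrite eqn_leq jump_le // e leqnn /=.
case: m => // m in mn l e *; rewrite ltnNge jump_le ?(ltnW mn) //.
by rewrite -ltnNge.
Qed.

(** Since the entry for [g m] is [m] when [g] jumps at [m], the hypothesis turns a
    jump at [m] into a jump at [m.+1] as long as [a + m <= n]. *)
Lemma jumps_run g n a k : counter g n -> 0 < a -> 1 <= k <= g n ->
    (forall j, k <= j <= g n -> a + nth 0 (jumps g n) j.-1 <= n ->
       j < g n /\ nth 0 (jumps g n) j = (nth 0 (jumps g n) j.-1).+1) ->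
  forall m, nth 0 (jumps g n) k.-1 <= m -> a + m <= n.+1 ->
    k <= g m /\ g m = (g m.-1).+1.
Proof.
move=> c a0 kn H; case: (c) => g0 h.
have [p [e pn e1 e2]] := nth_jumps g n k g0 h kn.
rewrite e => m /subnKC <-; elim: (m - p.+1) => [|d IH].
  by rewrite addn0 e2 /= e1; lia.
rewrite addnS; move: (p.+1 + d) IH => {}m IH am.
have [k1 k2] := IH ltac:(lia).
have gm : g m <= g n by apply: counter_le c _ _; lia.
have em : nth 0 (jumps g n) (g m).-1 = m by apply: jump_at => //; lia.
have [||l e3] := H (g m); [lia|rewrite em; lia|].
rewrite em in e3.
have [|q [e4 qn e5 e6]] := nth_jumps g n (g m).+1 g0 h; first by lia.
move: e4; rewrite /= e3 => -[eq]; rewrite eq e5 e6 /=; lia.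
Qed.

Definition prefix_lis (w : seq nat) m := row_len (take m w) 0.
Definition suffix_lis (w : seq nat) m := row_len (drop (size w - m) w) 0.

Lemma row_len_nil r : row_len [::] r = 0. Proof. by rewrite /row_len nth_nil. Qed.

Lemma prefix_lis_counter w : counter (prefix_lis w) (size w).
Proof.
split=> [|m l]; first by rewrite /prefix_lis take0 row_len_nil.
by rewrite /prefix_lis (take_nth 0 l) lis_rcons.
Qed.

Lemma suffix_lis_counter (w : seq nat) : uniq w -> counter (suffix_lis w) (size w).
Proof.
move=> u; split=> [|m l]; first by rewrite /suffix_lis subn0 drop_size row_len_nil.
have e : (size w - m.+1).+1 = size w - m by rewrite subnSK.
rewrite /suffix_lis (drop_nth 0 (n := size w - m.+1)) ?e ?leq_subr //.
apply: lis_cons; by rewrite -e -drop_nth ?drop_uniq // e leq_subr.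
Qed.

Lemma prefix_lis_size w : prefix_lis w (size w) = row_len w 0.
Proof. by rewrite /prefix_lis take_size. Qed.

Lemma suffix_lis_size w : suffix_lis w (size w) = row_len w 0.
Proof. by rewrite /suffix_lis subnn drop0. Qed.

Lemma prefix_lis_cat w1 w2 : prefix_lis (w1 ++ w2) (size w1) = row_len w1 0.
Proof. by rewrite /prefix_lis take_size_cat. Qed.

Lemma suffix_lis_cat w1 w2 : suffix_lis (w1 ++ w2) (size w2) = row_len w2 0.
Proof. by rewrite /suffix_lis size_cat addnK drop_size_cat. Qed.

(** * Subsequences with a single descent *)

Lemma subseq_split (w s1 s2 : seq nat) x : subseq (s1 ++ x :: s2) w ->
  exists w1 w2 : seq nat, [/\ w = w1 ++ x :: w2, subseq s1 w1 & subseq s2 w2].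
Proof.
elim: w s1 => [|z w IH] s1; first by rewrite subseq0; case: s1.
case: s1 => [|y s1] /=; case: eqP => [->|_] h.
- by exists [::], w.
- by have [w1 [w2 [-> _ h2]]] := IH [::] h; exists (z :: w1), w2.
- have [w1 [w2 [-> h1 h2]]] := IH _ h; exists (z :: w1), w2; split=> //.
  by rewrite /= eqxx.
- have [w1 [w2 [-> h1 h2]]] := IH (y :: s1) h; exists (z :: w1), w2; split=> //.
  exact: subseq_trans h1 (subseq_cons _ _).
Qed.

(** A longest increasing subsequence of [xyw] starts with [x], and what follows is
    longest for [yw], so it starts with [y]. *)
Lemma lis_jumps_lt (w : seq nat) x y : uniq (x :: y :: w) ->
    row_len (x :: y :: w) 0 = (row_len (y :: w) 0).+1 ->
    row_len (y :: w) 0 = (row_len w 0).+1 ->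
  x < y.
Proof.
move=> u e1 e2; have [v [sv so sz]] := lis_jump_cons _ _ u e1.
have uw : uniq w by case/and3P: u.
case: v sv so sz => [|z v] sv so sz; first by rewrite e2 in sz.
move: sv => /=; case: eqP => [<-|_] sv; first by case/andP: so.
by have := lis_le w _ uw sv (path_sorted so); rewrite sz e2 ltnn.
Qed.

Lemma lis_jumps_chain x (wm : seq nat) y (w : seq nat) : uniq (x :: wm ++ y :: w) ->
    (forall (w' : seq nat) z (w'' : seq nat),
       x :: wm ++ y :: w = w' ++ z :: w'' -> size w <= size w'' ->
       row_len (z :: w'') 0 = (row_len w'' 0).+1) ->
  x < y.
Proof.
elim: wm x => [|z wm IH] x u H.
  by apply: (lis_jumps_lt w) => //; [apply: (H [::])|apply: (H [:: x])].
have zy : z < y.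
  apply: IH => [|w' t w'' e l]; first by case/andP: u.
  by apply: (H (x :: w')) => //; rewrite /= -e.
apply: ltn_trans zy; apply: (lis_jumps_lt (wm ++ y :: w)) => //.
  by apply: (H [::]) => //=; rewrite size_cat /=; lia.
by apply: (H [:: x]) => //; rewrite size_cat /=; lia.
Qed.

(** The letters [x] and [y] at the descent sit in a prefix of length at least [a] and
    a suffix of length at least [b (size v).+1].  Without an admissible [j] the
    jumps of [suffix_lis] would fill the whole range between them, and
    [lis_jumps_chain] would give [x < y]. *)
Lemma two_runs_upper (w u v : seq nat) x y : uniq w ->
    subseq (rcons u x ++ y :: v) w -> sorted ltn (rcons u x) -> sorted ltn (y :: v) ->
    y < x ->
    let i := (size u).+1 in let l := row_len w 0 in
    let a := nth 0 (jumps (prefix_lis w) (size w)) i.-1 in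
    let b j := nth 0 (jumps (suffix_lis w) (size w)) j.-1 in
  exists j, [/\ size v < j, j <= l, i <= l, a + b j <= size w &
    (j == l) || (b j.+1 != (b j).+1)].
Proof.
move=> uw s su sv yx i l a b.
have [w1 [w3 [ew s1 s3]]] : exists w1 w3 : seq nat,
    [/\ w = w1 ++ x :: w3, subseq u w1 & subseq (y :: v) w3].
  by apply: subseq_split; rewrite -cat_rcons.
have [wm [w2 [ew3 _ s2]]] := subseq_split w3 [::] v y s3.
have cp := prefix_lis_counter w; have cs := suffix_lis_counter w uw.
have i1 : i <= prefix_lis w (size w1).+1.
  have -> : (size w1).+1 = size (rcons w1 x) by rewrite size_rcons.
  rewrite ew -cat_rcons prefix_lis_cat /i -(size_rcons u x); apply: lis_le => //.
    by move: uw; rewrite ew -cat_rcons cat_uniq => /andP[].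
  by rewrite -!cats1 cat_subseq.
have k1 : (size v).+1 <= suffix_lis w (size w2).+1.
  rewrite ew ew3 -cat_cons catA -[(size w2).+1]/(size (y :: w2)) suffix_lis_cat.
  rewrite -[(size v).+1]/(size (y :: v)); apply: lis_le => //; last by rewrite /= eqxx.
  by move: uw; rewrite ew ew3 -cat_cons catA cat_uniq => /and3P[].
have sz : size w = size w1 + (size wm + (size w2).+1).+1.
  by rewrite ew ew3 size_cat /= size_cat.
have il : i <= l.
  by rewrite /l -prefix_lis_size; apply: leq_trans i1 (counter_le _ _ _ _ cp _ _); lia.
have kl : (size v).+1 <= l.
  by rewrite /l -suffix_lis_size; apply: leq_trans k1 (counter_le _ _ _ _ cs _ _); lia.
have a1 : a <= (size w1).+1 by rewrite /a jump_le ?prefix_lis_size //; lia.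
have b1 : b (size v).+1 <= (size w2).+1 by rewrite /b jump_le ?suffix_lis_size //; lia.
have a0 : 0 < a.
  have [|p [e _ _ _]] := nth_jumps _ _ i cp.1 cp.2; first by rewrite prefix_lis_size.
  by rewrite /a e.
pose P j := (a + b j <= size w) && ((j == l) || (b j.+1 != (b j).+1)).
have [|no] := boolP (has P (index_iota (size v).+1 l.+1)).
  case/hasP => j; rewrite mem_index_iota => /andP[h1 h2] /andP[h3 h4].
  by exists j; split.
have run := jumps_run (suffix_lis w) (size w) a (size v).+1 cs a0.
have {}run m : b (size v).+1 <= m -> a + m <= (size w).+1 ->
    suffix_lis w m = (suffix_lis w m.-1).+1.
  move=> bm am; have [||//] := run _ _ m bm am; first by rewrite suffix_lis_size.
  move=> j; rewrite suffix_lis_size -/l => jl aj.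
  have := hasPn no j; rewrite mem_index_iota ltnS jl => /(_ isT).
  rewrite /P aj /= negb_or negbK => /andP[jl' /eqP e]; split=> //.
  by rewrite ltn_neqAle jl'; case/andP: jl.
have : x < y; last by lia.
apply: (lis_jumps_chain x wm y w2); first by move: uw; rewrite ew ew3 cat_uniq => /and3P[].
move=> w' z w'' e le.
have ew' : w = (w1 ++ w') ++ z :: w'' by rewrite ew ew3 e catA.
have sz' : size w = size w1 + size w' + (size w'').+1 by rewrite ew' !size_cat.
have l1 : b (size v).+1 <= (size w'').+1 by apply: leq_trans b1 _.
have l2 : a + (size w'').+1 <= (size w).+1.
  by move: sz'; lia.
have := run _ l1 l2; rewrite succnK.
have -> : suffix_lis w (size w'').+1 = row_len (z :: w'') 0.
  by rewrite ew' -[(size w'').+1]/(size (z :: w'')) suffix_lis_cat.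
by rewrite ew' -cat_rcons suffix_lis_cat.
Qed.

(** The prefix of length [a] ends in the last letter [x] of an increasing
    subsequence of length [i], and the suffix of length [b j] starts with the
    first letter [y] of one of length [j]. *)
Lemma two_runs_lower (w : seq nat) i j : uniq w ->
    let l := row_len w 0 in
    let a := nth 0 (jumps (prefix_lis w) (size w)) i.-1 in
    let b j := nth 0 (jumps (suffix_lis w) (size w)) j.-1 in
    1 <= i <= l -> 1 <= j <= l -> a + b j <= size w ->
    (j == l) || (b j.+1 != (b j).+1) ->
  exists u x y v, [/\ subseq (rcons u x ++ y :: v) w, sorted ltn (rcons u x),
    sorted ltn (y :: v), y < x & (size u).+1 = i /\ (size v).+1 = j].
Proof.
move=> uw l a b il jl; have cp := prefix_lis_counter w; have cs := suffix_lis_counter w uw.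
have [|p [ea pn p1 p2]] := nth_jumps _ _ i cp.1 cp.2; first by rewrite prefix_lis_size.
have [|q [eb qn q1 q2]] := nth_jumps _ _ j cs.1 cs.2; first by rewrite suffix_lis_size.
rewrite {}/a /b ea eb => ab cond.
have [w1 [x [wm [y [w2 [ew sw1 sw2]]]]]] :
    exists (w1 : seq nat) x (wm : seq nat) y (w2 : seq nat),
    [/\ w = w1 ++ x :: wm ++ y :: w2, size w1 = p & size w2 = q].
  exists (take p w), (nth 0 w p), (take (size w - q.+1 - p.+1) (drop p.+1 w)),
    (nth 0 w (size w - q.+1)), (drop (size w - q) w).
  have e1 : size w - q.+1 - p.+1 + p.+1 = size w - q.+1 by lia.
  have e2 : (size w - q.+1).+1 = size w - q by lia.
  rewrite size_take pn size_drop -[in drop (_ - q) w]e2 -drop_nth; last by lia.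
  rewrite -[in drop (_ - q.+1) w]e1 -drop_drop cat_take_drop -drop_nth // cat_take_drop.
  by split=> //; lia.
have X1 : row_len w1 0 = i.-1 by rewrite -(prefix_lis_cat w1 (x :: wm ++ y :: w2)) -ew sw1.
have X2 : row_len (rcons w1 x) 0 = i.
  by rewrite -(prefix_lis_cat _ (wm ++ y :: w2)) cat_rcons -ew size_rcons sw1.
have ew' : w = (w1 ++ x :: wm) ++ y :: w2 by rewrite -catA.
have Y1 : row_len w2 0 = j.-1.
  by rewrite -(suffix_lis_cat (rcons (w1 ++ x :: wm) y)) cat_rcons -ew' sw2.
have Y2 : row_len (y :: w2) 0 = j.
  by rewrite -(suffix_lis_cat (w1 ++ x :: wm)) -ew' /= sw2.
have u1 : uniq (rcons w1 x).
  by move: uw; rewrite ew -cat_rcons cat_uniq => /andP[].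
have u2 : uniq (y :: w2) by move: uw; rewrite ew' cat_uniq => /and3P[].
have [|u [su ou zu]] := lis_jump_rcons w1 x u1; first by lia.
have [|v [sv ov zv]] := lis_jump_cons w2 y u2; first by lia.
have ev : (size v).+1 = j by lia.
have eu : (size u).+1 = i by lia.
(* [z] is the letter just before [y], which is [x] itself if [wm] is empty. *)
have [m ez] : exists m : seq nat, x :: wm = rcons m (last x wm).
  by exists (belast x wm); rewrite lastI.
set z := last x wm in ez.
have ewz : w = (w1 ++ m) ++ z :: y :: w2 by rewrite ew' ez -cats1 -!catA.
have u3 : uniq (z :: y :: w2) by move: uw; rewrite ewz cat_uniq => /and3P[].
(* Otherwise [suffix_lis] would reach [j.+1] one step after [j]. *)
have zj : row_len (z :: y :: w2) 0 <= j.
  rewrite leqNgt; apply/negP => h.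
  have e3 : suffix_lis w q.+2 = row_len (z :: y :: w2) 0.
    by rewrite ewz -(suffix_lis_cat (w1 ++ m)) /= sw2.
  have q2n : q.+2 <= size w by rewrite ewz size_cat /= sw2; lia.
  have e4 : suffix_lis w q.+2 = j.+1.
    by have := cs.2 q.+1 q2n; lia.
  have := jump_at _ _ j.+1 q.+2 cs q2n isT _ e4; rewrite /= q2 => /(_ (leqnn _)) e5.
  move: cond; rewrite e5 eqxx orbF => /eqP e6.
  by have := counter_le _ _ _ _ cs q2n (leqnn _); rewrite suffix_lis_size -/l; lia.
have yz : y < z.
  rewrite ltnNge leq_eqVlt; apply/negP => /orP[/eqP e|zy].
    by move: u3; rewrite e /= mem_head.
  have := lis_le _ (z :: y :: v) u3; rewrite /= !eqxx sv (ov : path ltn y v) zy => /(_ isT isT).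
  by lia.
have svy : subseq (y :: v) (y :: w2) by rewrite /= eqxx.
case: (ltngtP y x) => [yx|xy|exy].
- exists u, x, y, v; split=> //.
  rewrite ew -(cat_rcons x); apply: cat_subseq; first by rewrite -!cats1 cat_subseq.
  exact: subseq_trans svy (suffix_subseq _ _).
- have nm : wm != [::] by apply: contraTneq yz => e; rewrite /z e /=; lia.
  have [wm' ewm] : exists wm' : seq nat, wm = rcons wm' z.
    by move: nm; rewrite /z; case/lastP: (wm) => // s t _; exists s; rewrite last_rcons.
  have o3 : sorted ltn (rcons (rcons u x) z).
    by rewrite sorted_rcons_last ou last_rcons; apply/orP; right; lia.
  have s3 : subseq (rcons (rcons u x) z ++ y :: v) w.
    rewrite ew ewm -(cat_rcons x) -[rcons wm' z]cats1 -!catA catA.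
    rewrite -[rcons (rcons u x) z]cats1 -catA; apply: cat_subseq.
      by apply: subseq_trans (prefix_subseq _ _); rewrite -!cats1 cat_subseq.
    exact: cat_subseq.
  (* Delete the first letter of the sequence [rcons (rcons u x) z], which has one
     letter too many; if [u] is empty, that letter is [x]. *)
  case: u => [|c u] in su ou zu eu o3 s3 *.
    exists [::], z, y, v; split=> //.
    exact: subseq_trans (subseq_cons _ _) s3.
  exists (rcons u x), z, y, v; split=> //; [|exact: path_sorted o3|by rewrite size_rcons].
  exact: subseq_trans (subseq_cons _ _) s3.
- move: uw; rewrite ew -exy cat_uniq /= mem_cat mem_head orbT /=.
  by rewrite !andbF.
Qed.

(** * Descent sets of subwords of a permutation *)

Lemma mem_Des (s : seq nat) k :
  (k \in Des s) = [&& 0 < k, k < size s & nth 0 s k < nth 0 s k.-1].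
Proof.
rewrite /Des !inE /= mem_iota; case: (size s) => [|n]; last by rewrite /= add1n andbA.
by case: k.
Qed.

(** For distinct letters, the absence of descents inside a run makes it strictly
    increasing. *)
Lemma Des_two_runs (s : seq nat) i : uniq s -> 0 < i ->
  Des s = [fset i]%fset <-> exists u x y v,
    [/\ s = rcons u x ++ y :: v, sorted ltn (rcons u x), sorted ltn (y :: v),
        y < x & (size u).+1 = i].
Proof.
move=> us i0; split=> [e|[u [x [y [v [-> su sv yx <-]]]]]].
  have inD k : (k \in Des s) = (k == i) by rewrite e inE.
  have := inD i; rewrite eqxx mem_Des i0 /= => /andP[il d].
  have nod k : k.+1 < size s -> k.+1 != i -> nth 0 s k < nth 0 s k.+1.
    move=> kl ki; have := inD k.+1; rewrite (negbTE ki) mem_Des kl /= => /negbT.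
    rewrite -leqNgt leq_eqVlt => /orP[|//].
    by rewrite nth_uniq //; [lia|exact: ltnW].
  have st : size (take i s) = i by rewrite size_take il.
  have es : take i s = rcons (take i.-1 s) (nth 0 s i.-1).
    by rewrite -take_nth ?prednK //; lia.
  exists (take i.-1 s), (nth 0 s i.-1), (nth 0 s i), (drop i.+1 s).
  rewrite -es -drop_nth // cat_take_drop; split=> //.
  - apply/(sortedP 0) => k; rewrite st => kl; rewrite !nth_take ?(ltnW kl) //.
    by apply: nod; lia.
  - rewrite -[path _ _ _]/(sorted ltn (_ :: _)) -drop_nth //.
    apply/(sortedP 0) => k; rewrite size_drop => kl; rewrite !nth_drop addnS.
    by apply: nod; lia.
  - by rewrite size_take; case: ltnP; lia.
apply/fsetP => k; rewrite mem_Des inE.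
rewrite size_cat size_rcons.
have [->|] := eqVneq k (size u).+1.
  by rewrite /= !nth_cat size_rcons ltnn subnn ltnSn nth_rcons ltnn eqxx yx; lia.
case: k => // k kn; apply/negP => /and3P[_ kl].
rewrite /= !nth_cat !size_rcons.
case: (ltngtP k.+1 (size u).+1) => [l1|l1|]; last by move/eqP: kn.
  have /= lt : ltn (nth 0 (rcons u x) k) (nth 0 (rcons u x) k.+1).
    by apply: (sortedP 0 su); rewrite size_rcons.
  by lia.
have -> : k.+1 - (size u).+1 = (k - (size u).+1).+1 by lia.
have lt : ltn (nth 0 (y :: v) (k - (size u).+1)) (nth 0 (y :: v) (k - (size u).+1).+1).
  by apply: (sortedP 0 sv); move: kl => /=; lia.
by apply/negP; rewrite -leqNgt ltnW.
Qed.

Definition letter {n} (pi : 'S_n) (k : 'I_n) : nat := (pi k : nat).+1.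

Lemma letter_inj {n} (pi : 'S_n) : injective (letter pi).
Proof. by move=> j k [] /ord_inj /perm_inj. Qed.

Lemma subword_uniq {n} (pi : 'S_n) I : uniq (subword pi I).
Proof. by rewrite (map_inj_uniq (@letter_inj n pi)) enum_uniq. Qed.

Lemma size_subword {n} (pi : 'S_n) I : size (subword pi I) = #|I|.
Proof. by rewrite size_map cardE. Qed.

Lemma subword_subseq {n} (pi : 'S_n) I : subseq (subword pi I) (subword pi [set: 'I_n]).
Proof.
apply: map_subseq; have -> : enum [set: 'I_n] = Finite.enum 'I_n.
  by apply/all_filterP/allP => k _; rewrite /= inE.
exact: filter_subseq.
Qed.

(** The letters are distinct, so a subsequence is determined by its set of letters. *)
Lemma subseq_subword {n} (pi : 'S_n) s : subseq s (subword pi [set: 'I_n]) ->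
  exists I, subword pi I = s.
Proof.
move=> ss; exists [set k | letter pi k \in s].
rewrite [RHS](subseq_uniqP (subword_uniq pi [set: 'I_n]) ss).
rewrite /subword filter_map /enum_mem; congr map.
rewrite -filter_predI; apply: eq_filter => k; by rewrite /= !inE andbT.
Qed.

Theorem proposition4p6 (n : nat) (pi : 'S_n) (i : nat) (hi : 1 <= i) :
  let Q := Qtab pi in
  let Qe := evac Q in
  ls [fset i]%fset pi =
  \max_(1 <= j < (len1 Q).+1 |
          [&& i <= len1 Q,
              entry1 Q i + entry1 Qe j <= n
            & (j == len1 Q) || (entry1 Qe j.+1 != (entry1 Qe j).+1)])
     (i + j).
Proof.
move=> Q Qe; set w := subword pi [set: 'I_n].
have uw : uniq w by apply: subword_uniq.
have sw : size w = n by rewrite size_subword cardsT card_ord.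
have hQ : head [::] Q = jumps (prefix_lis w) (size w) by apply: head_Q_tab.
have hQe : head [::] Qe = jumps (suffix_lis w) (size w) by apply: head_evac_Q_tab.
have cp := prefix_lis_counter w.
have l1 : len1 Q = row_len w 0 by rewrite /len1 hQ (size_jumps _ _ cp.1 cp.2) prefix_lis_size.
rewrite /entry1 l1 hQ hQe /ls.
apply/eqP; rewrite eqn_leq; apply/andP; split.
  apply/bigmax_leqP => I /eqP dI.
  have [u [x [y [v [e su sv yx iE]]]]] :=
    (Des_two_runs _ _ (subword_uniq pi I) hi).1 dI.
  have := subword_subseq pi I; rewrite e -/w => sI.
  have [j [vj jl il ab cond]] := two_runs_upper w u v x y uw sI su sv yx.
  rewrite iE in il ab.
  have -> : #|I| = i + (size v).+1.
    by rewrite -(size_subword pi) e size_cat size_rcons iE.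
  apply: leq_trans (leq_bigmax_seq j _ _); first by rewrite leq_add2l.
    by rewrite mem_index_iota; lia.
  by rewrite il /= cond andbT -[X in _ <= X]sw.
apply/bigmax_leqP_seq => j; rewrite mem_index_iota => jl /and3P[il ab cond].
rewrite -[X in _ <= X]sw in ab.
have [||u [x [y [v [ss su sv yx [eu ev]]]]]] := two_runs_lower w i j uw _ _ ab cond;
  [by rewrite hi|exact: jl|].
have [I eI] := subseq_subword pi _ ss.
apply: (leq_trans _ (leq_bigmax_cond I _)).
  by rewrite -(size_subword pi) eI size_cat size_rcons /= eu ev.
apply/eqP/(Des_two_runs _ _ (subword_uniq pi I) hi).
by exists u, x, y, v.
Qed.
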